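(* Let $(G,V,f)$ be an instance of coset identification and let $t\ge 1$ and $P\in[0,1]$. Then there exists a $t$-query (adaptive) quantum algorithm that determines $f(a)$ with average success probability $P$ if and only if there exists a $t$-query nonadaptive quantum algorithm that determines $f(a)$ with average success probability $P$.
   Context: A symmetric quantum oracle problem is a triple $(G,V,f)$ where $G$ is a finite group, $\pi:G\to U(V)$ is a unitary representation on a finite-dimensional Hilbert space $V$, and $f:G\to X$ is a function. It is an instance of coset identification if $X$ is a transitive left $G$-set and $f$ is a surjective map of left $G$-sets ($f(gh)=g\cdot f(h)$); equivalently $f$ is constant on the left cosets of the subgroup $H=\{g\in G: f(g)=f(e)\}$ and takes distinct values on distinct left cosets. A $t$-query adaptive algorithm consists of an integer $N\ge1$, a unit vector $\psi\in V\otimes\mathbb{C}^N$, unitaries $U_1,\dots,U_t$ on $V\otimes\mathbb{C}^N$ and a POVM $\{E_x\}_{x\in X}$ on $V\otimes\mathbb{C}^N$; on hidden element $a\in G$ it produces $\psi_a=U_t(\pi(a)\otimes I)U_{t-1}(\pi(a)\otimes I)\cdots U_1(\pi(a)\otimes I)\psi$ and outputs $x$ with probability $\langle\psi_a|E_x|\psi_a\rangle$. A $t$-query nonadaptive algorithm consists of $N\ge1$, a unit vector $\psi\in V^{\otimes t}\otimes\mathbb{C}^N$ and a POVM $\{E_x\}_{x\in X}$; on hidden $a$ it produces $\psi_a=(\pi(a)^{\otimes t}\otimes I)\psi$. In both cases the (average) success probability is $\frac1{|G|}\sum_{a\in G}\langle\psi_a|E_{f(a)}|\psi_a\rangle$,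 with $a$ uniform on $G$. *)

(* Defs.v *)
From HB Require Import structures.
From mathcomp Require Import all_boot all_order all_fingroup all_algebra.
Set Implicit Arguments. Unset Strict Implicit. Unset Printing Implicit Defensive.
Import Order.TTheory GRing.Theory Num.Theory.
Local Open Scope ring_scope.

Section QDefs.
Variable C : numClosedFieldType.

Definition adjmx m n (A : 'M[C]_(m, n)) : 'M[C]_(n, m) := (map_mx Num.conj A)^T.

Definition unitarymx n (U : 'M[C]_n) : Prop := adjmx U *m U = 1%:M.

Definition qform n (A : 'M[C]_n) (v : 'cV[C]_n) : C := (adjmx v *m A *m v) 0 0.

Definition unit_vector n (v : 'cV[C]_n) : Prop := adjmx v *m v = 1%:M.

Definition psdmx n (A : 'M[C]_n) : Prop :=
  adjmx A = A /\ forall v : 'cV[C]_n, 0 <= qform A v.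

Definition is_POVM (X : finType) n (E : X -> 'M[C]_n) : Prop :=
  (forall x, psdmx (E x)) /\ \sum_(x : X) E x = 1%:M.

Definition tidx m n (k : 'I_(m * n)) : 'I_m * 'I_n :=
  enum_val (cast_ord (esym (mxvec_cast m n)) k).

Definition kron m1 n1 m2 n2 (A : 'M[C]_(m1, n1)) (B : 'M[C]_(m2, n2))
  : 'M[C]_(m1 * m2, n1 * n2) :=
  \matrix_(i, j) (A (tidx i).1 (tidx j).1 * B (tidx i).2 (tidx j).2).

Fixpoint tdim (d k : nat) : nat :=
  match k with O => 1%N | S k' => (d * tdim d k')%N end.

Fixpoint tpow d (A : 'M[C]_d) (k : nat) : 'M[C]_(tdim d k) :=
  match k return 'M[C]_(tdim d k) with
  | O => 1%:M
  | S k' => kron A (tpow A k')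
  end.

Definition unitary_rep (gT : finGroupType) d (pi : gT -> 'M[C]_d) : Prop :=
  pi 1%g = 1%:M /\ (forall g h, pi (g * h)%g = pi g *m pi h)
  /\ (forall g, unitarymx (pi g)).

Definition adaptive_state d N (A : 'M[C]_d) (Us : seq 'M[C]_(d * N))
  (psi : 'cV[C]_(d * N)) : 'cV[C]_(d * N) :=
  foldl (fun s U => U *m (kron A (1%:M : 'M[C]_N) *m s)) psi Us.

Definition nonadaptive_state d N t (A : 'M[C]_d) (psi : 'cV[C]_(tdim d t * N))
  : 'cV[C]_(tdim d t * N) :=
  kron (tpow A t) (1%:M : 'M[C]_N) *m psi.

End QDefs.

Definition coset_identification (gT : finGroupType) (X : finType)
  (lact : gT -> X -> X) (f : gT -> X) : Prop :=
  (forall x, lact 1%g x = x)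
  /\ (forall g h x, lact (g * h)%g x = lact g (lact h x))
  /\ (forall x y, exists g, lact g x = y)
  /\ (forall x, exists g, f g = x)
  /\ (forall g h, f (g * h)%g = lact g (f h)).

Definition avg_success (C : numClosedFieldType) (gT : finGroupType) (X : finType)
  n (f : gT -> X) (E : X -> 'M[C]_n) (state : gT -> 'cV[C]_n) : C :=
  (#|gT|%:R)^-1 * \sum_(a : gT) qform (E (f a)) (state a).

Definition adaptive_algorithm_exists (C : numClosedFieldType) (gT : finGroupType)
  (X : finType) d (pi : gT -> 'M[C]_d) (f : gT -> X) (t : nat) (P : C) : Prop :=
  exists (N : nat) (psi : 'cV[C]_(d * N)) (Us : seq 'M[C]_(d * N))
         (E : X -> 'M[C]_(d * N)),
    [/\ (0 < N)%N, unit_vector psi, size Us = t,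
        (forall U, U \in Us -> unitarymx U) &
      is_POVM E /\
        avg_success f E (fun a => adaptive_state (pi a) Us psi) = P].

Definition nonadaptive_algorithm_exists (C : numClosedFieldType) (gT : finGroupType)
  (X : finType) d (pi : gT -> 'M[C]_d) (f : gT -> X) (t : nat) (P : C) : Prop :=
  exists (N : nat) (psi : 'cV[C]_(tdim d t * N)) (E : X -> 'M[C]_(tdim d t * N)),
    [/\ (0 < N)%N, unit_vector psi, is_POVM E &
        avg_success f E (fun a => @nonadaptive_state C d N t (pi a) psi) = P].

(* Main.v *)
(* From adaptive to nonadaptive: every entry of the adaptive state psi_a is a
   linear form in the entries of pi(a)^{(x)t}, so psi_a = L R(a) v for the
   representation R = pi^{(x)t} (x) 1, a fixed operator L and a fixed vector v.  The
   average S of R(g)^* L^* L R(g) over g commutes with R, so phi = sqrt(S) v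
   satisfies R(a) phi = sqrt(S) R(a) v, and the states R(a) phi have the same
   Gram matrix as the symmetrised states |G|^(-1/2) sum_g psi_{ga} (x) |g>.
   Measuring g and then, in the g-branch, E_{gx}, identifies f(a) with the average
   success probability of the adaptive algorithm, for every a; this measurement is
   pulled back along the pseudo-inverse of sqrt(S).

   From nonadaptive to adaptive: pi(a)^{(x)t} (x) 1 is a product of t operators,
   each of the form S (pi(a) (x) 1) S^* with S a permutation of the tensor
   factors, and these permutations become the unitaries U_i. *)

Require Import Defs.
From HB Require Import structures.
From mathcomp Require Import all_boot all_order all_fingroup all_algebra.
Import Order.TTheory GRing.Theory Num.Theory.
Local Open Scope ring_scope.
Set Implicit Arguments. Unset Strict Implicit. Unset Printing Implicit Defensive.

(** * Adjoints, quadratic forms and positive semidefinite matrices *)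

Section HermitianMatrices.
Variable C : numClosedFieldType.

Lemma adjmxK m n (A : 'M[C]_(m, n)) : adjmx (adjmx A) = A.
Proof. by apply/matrixP=> i j; rewrite !mxE conjCK. Qed.

Lemma adjmxM m n p (A : 'M[C]_(m, n)) (B : 'M_(n, p)) :
  adjmx (A *m B) = adjmx B *m adjmx A.
Proof. by rewrite /adjmx map_mxM trmx_mul. Qed.

Lemma adjmxZ m n (c : C) (A : 'M[C]_(m, n)) : adjmx (c *: A) = c^* *: adjmx A.
Proof. by apply/matrixP=> i j; rewrite !mxE rmorphM. Qed.

Lemma adjmx_sum m n (I : finType) (A : I -> 'M[C]_(m, n)) :
  adjmx (\sum_i A i) = \sum_i adjmx (A i).
Proof. by rewrite /adjmx map_mx_sum raddf_sum. Qed.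

Lemma adjmx1 n : adjmx (1%:M : 'M[C]_n) = 1%:M.
Proof. by rewrite /adjmx map_mx1 trmx1. Qed.

Lemma qform_conj m n (A : 'M[C]_m) (B : 'M_(m, n)) v :
  qform (adjmx B *m A *m B) v = qform A (B *m v).
Proof. by rewrite /qform adjmxM !mulmxA. Qed.

Lemma qformD n (A B : 'M[C]_n) v : qform (A + B) v = qform A v + qform B v.
Proof. by rewrite /qform mulmxDr mulmxDl mxE. Qed.

Lemma qformZ n c (A : 'M[C]_n) v : qform (c *: A) v = c * qform A v.
Proof. by rewrite /qform -scalemxAr -scalemxAl mxE. Qed.

Lemma qform_sum n (I : finType) (A : I -> 'M[C]_n) v :
  qform (\sum_i A i) v = \sum_i qform (A i) v.
Proof. by rewrite /qform mulmx_sumr mulmx_suml summxE. Qed.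

Lemma qform1E n (v : 'cV[C]_n) : qform 1%:M v = \sum_i `|v i 0| ^+ 2.
Proof.
rewrite /qform mulmx1 mxE; apply: eq_bigr => i _.
by rewrite !mxE mulrC normCK.
Qed.

Lemma qform1_ge0 n (v : 'cV[C]_n) : 0 <= qform 1%:M v.
Proof. by rewrite qform1E; apply: sumr_ge0 => i _; rewrite exprn_ge0. Qed.

Lemma qform1_eq0 n (v : 'cV[C]_n) : qform 1%:M v = 0 -> v = 0.
Proof.
rewrite qform1E => /psumr_eq0P v0; apply/matrixP=> i j; rewrite ord1 mxE.
apply/eqP; rewrite -normr_eq0 -sqrf_eq0 v0 // => k _.
by rewrite exprn_ge0.
Qed.

Lemma unit_vectorE n (v : 'cV[C]_n) : unit_vector v <-> qform 1%:M v = 1.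
Proof.
rewrite /unit_vector /qform mulmx1; split=> [->|v1]; first by rewrite mxE.
by apply/matrixP=> i j; rewrite !ord1 v1 mxE.
Qed.

Lemma psdmx_conj m n (A : 'M[C]_m) (B : 'M_(m, n)) :
  psdmx A -> psdmx (adjmx B *m A *m B).
Proof.
move=> [Ah A0]; split; first by rewrite !adjmxM adjmxK Ah mulmxA.
by move=> v; rewrite qform_conj.
Qed.

Lemma psdmx1 n : psdmx (1%:M : 'M[C]_n).
Proof. by split=> [|v]; [rewrite adjmx1 | exact: qform1_ge0]. Qed.

Lemma psdmx_gram m n (B : 'M[C]_(m, n)) : psdmx (adjmx B *m B).
Proof. by rewrite -[adjmx B]mulmx1; apply/psdmx_conj/psdmx1. Qed.

Lemma psdmxD n (A B : 'M[C]_n) : psdmx A -> psdmx B -> psdmx (A + B).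
Proof.
move=> [Ah A0] [Bh B0]; split=> [|v]; last by rewrite qformD addr_ge0.
by rewrite -{2}Ah -{2}Bh /adjmx map_mxD linearD.
Qed.

Lemma psdmxZ n c (A : 'M[C]_n) : 0 <= c -> psdmx A -> psdmx (c *: A).
Proof.
move=> c0 [Ah A0]; split=> [|v]; last by rewrite qformZ mulr_ge0.
by rewrite adjmxZ Ah geC0_conj.
Qed.

Lemma psdmx_sum n (I : finType) (A : I -> 'M[C]_n) :
  (forall i, psdmx (A i)) -> psdmx (\sum_i A i).
Proof.
move=> Apsd; split=> [|v].
  by rewrite adjmx_sum; apply: eq_bigr => i _; case: (Apsd i).
by rewrite qform_sum; apply: sumr_ge0 => i _; case: (Apsd i).
Qed.

(** * Functional calculus of a positive semidefinite matrix *)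

Definition calcmx n (S : 'M[C]_n) (h : C -> C) : 'M[C]_n :=
  adjmx (spectralmx S) *m diag_mx (map_mx h (spectral_diag S)) *m spectralmx S.

Section Calculus.
Variables (n : nat) (S : 'M[C]_n).

Lemma spectralmx_adjl : adjmx (spectralmx S) *m spectralmx S = 1%:M.
Proof.
have /unitarymxP/mulmx1C := spectral_unitarymx S.
by rewrite /adjmx map_trmx.
Qed.

Lemma spectralmx_adjr : spectralmx S *m adjmx (spectralmx S) = 1%:M.
Proof. exact: mulmx1C spectralmx_adjl. Qed.

Lemma calcmxM h k : calcmx S h *m calcmx S k = calcmx S (fun x => h x * k x).
Proof.
rewrite /calcmx !mulmxA -[_ *m spectralmx S *m _]mulmxA spectralmx_adjr mulmx1.
rewrite -[_ *m diag_mx _ *m diag_mx _]mulmxA mulmx_diag; congr (_ *m diag_mx _ *m _).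
by apply/rowP=> i; rewrite !mxE.
Qed.

Lemma calcmx_adj h : adjmx (calcmx S h) = calcmx S (fun x => (h x)^*).
Proof.
rewrite /calcmx !adjmxM adjmxK mulmxA; congr (_ *m _ *m _).
rewrite /adjmx map_diag_mx tr_diag_mx; congr diag_mx.
by apply/matrixP=> i j; rewrite !mxE.
Qed.

Lemma calcmxB h k : calcmx S (fun x => h x - k x) = calcmx S h - calcmx S k.
Proof.
rewrite /calcmx -mulmxBl -mulmxBr -linearB /=; congr (_ *m diag_mx _ *m _).
by apply/matrixP=> i j; rewrite !mxE.
Qed.

Lemma calcmx1 : calcmx S (fun=> 1) = 1%:M.
Proof.
rewrite /calcmx; set D := diag_mx _; have -> : D = 1%:M.
  by apply/matrixP=> i j; rewrite !mxE.
by rewrite mulmx1 spectralmx_adjl.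
Qed.

Hypothesis Spsd : psdmx S.

Lemma calcmx_id : calcmx S id = S.
Proof.
case: Spsd => Sh _.
have Snormal : S \is normalmx.
  by apply/normalmxP; rewrite -map_trmx; move: Sh; rewrite /adjmx map_trmx => ->.
rewrite [RHS](orthomx_spectralP Snormal) invmx_unitary ?spectral_unitarymx //.
rewrite /calcmx /adjmx map_trmx; congr (_ *m diag_mx _ *m _).
by apply/matrixP=> i j; rewrite !mxE.
Qed.

(** The eigenvalue is the value of the quadratic form of [S] at the [i]-th eigenvector, the [i]-th
    column of [adjmx (spectralmx S)]. *)
Lemma spectral_diag_ge0 i : 0 <= spectral_diag S 0 i.
Proof.
case: Spsd => _ /(_ (adjmx (spectralmx S) *m delta_mx i 0)).
have diagE : spectralmx S *m S *m adjmx (spectralmx S) = diag_mx (spectral_diag S).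
  rewrite -{2}calcmx_id /calcmx !mulmxA spectralmx_adjr mul1mx -mulmxA.
  rewrite spectralmx_adjr mulmx1; congr diag_mx.
  by apply/rowP=> j; rewrite !mxE.
rewrite -qform_conj adjmxK diagE.
rewrite /qform mul_mx_diag mxE (bigD1 i) //= big1 ?addr0 => [|j ji].
  by rewrite !mxE !eqxx conjC1 mul1r mulr1.
by rewrite !mxE (negPf ji) mulr0.
Qed.

(** Only the values at the eigenvalues enter, and these are nonnegative. Matrix identities involving
    [sqrtC] thus reduce to scalar ones on nonnegative numbers. *)
Lemma eq_calcmx h k : (forall x, 0 <= x -> h x = k x) -> calcmx S h = calcmx S k.
Proof.
move=> hk; congr (_ *m diag_mx _ *m _); apply/matrixP=> i j.
by rewrite !mxE ord1 hk ?spectral_diag_ge0.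
Qed.

(** Applying [sqrtC] after [h] exhibits [calcmx S h] as a Gram matrix. *)
Lemma calcmx_psd h : (forall x, 0 <= x -> 0 <= h x) -> psdmx (calcmx S h).
Proof.
move=> h0; have -> : calcmx S h =
    adjmx (calcmx S (sqrtC \o h)) *m calcmx S (sqrtC \o h).
  rewrite calcmx_adj calcmxM; apply: eq_calcmx => x /h0 hx.
  by rewrite /= geC0_conj ?sqrtC_ge0 // -expr2 sqrtCK.
exact: psdmx_gram.
Qed.

(* In an eigenbasis of [S], a matrix commutes with [S] iff its entries between
   distinct eigenvalues vanish. *)
Lemma calcmx_comm B h : B *m S = S *m B -> B *m calcmx S h = calcmx S h *m B.
Proof.
set U := spectralmx S.
have [B' B'E] : exists B', B' = U *m B *m adjmx U by exists (U *m B *m adjmx U).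
have BE : B = adjmx U *m B' *m U.
  by rewrite B'E !mulmxA spectralmx_adjl mul1mx -mulmxA spectralmx_adjl mulmx1.
have comm k : B *m calcmx S k = calcmx S k *m B <->
    B' *m diag_mx (map_mx k (spectral_diag S))
    = diag_mx (map_mx k (spectral_diag S)) *m B'.
  rewrite /calcmx -/U; set D := diag_mx _; split=> [/(congr1 (mulmx U)) |BD].
    move=> /(congr1 (mulmx^~ (adjmx U))).
    rewrite /= !mulmxA spectralmx_adjr mul1mx -!mulmxA spectralmx_adjr mulmx1.
    by rewrite B'E !mulmxA.
  rewrite BE !mulmxA -[_ *m U *m adjmx U]mulmxA spectralmx_adjr mulmx1.
  rewrite -[_ *m U *m adjmx U]mulmxA spectralmx_adjr mulmx1.
  by rewrite -[_ *m B' *m D]mulmxA BD mulmxA.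
rewrite -{1 2}calcmx_id => /comm/matrixP BS; apply/comm/matrixP=> i j.
have := BS i j; rewrite !mul_mx_diag !mul_diag_mx !mxE => /eqP.
rewrite mulrC -subr_eq0 -mulrBl mulf_eq0 subr_eq0 mulrC.
by case/orP=> [/eqP -> //|/eqP ->]; rewrite !mulr0.
Qed.

End Calculus.

(** * Group averaging and transfer to a nonadaptive measurement *)

Definition covariant_avg (gT : finGroupType) n (R : gT -> 'M[C]_n)
    (M : gT -> 'M_n) : 'M_n :=
  #|gT|%:R^-1 *: \sum_g adjmx (R g) *m M g *m R g.

(** The effects symmetrised over the group sum to an operator [S] commuting with [R]. Compressing
    them by the pseudo-inverse of the square root of [S] gives a measurement for the states
    [R a *m (Q *m v)], where [Q] is that square root. *)
Lemma nonadaptive_transfer (gT : finGroupType) (X : finType) (lact : gT -> X -> X)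
    (f : gT -> X) n p (R : gT -> 'M[C]_n) (L : 'M_(p, n)) v (E : X -> 'M_p) :
    unitary_rep R -> coset_identification lact f ->
    (forall a, unit_vector (L *m R a *m v)) -> is_POVM E ->
  exists (phi : 'cV_n) (E' : X -> 'M_n),
    [/\ unit_vector phi, is_POVM E' &
        avg_success f E' (fun a => R a *m phi)
        = avg_success f E (fun a => L *m R a *m v)].
Proof.
move=> [R1 [RM RU]] [lact1 [lactM [_ [_ fM]]]] Lv [Epsd E1].
have adjR h : adjmx (R h) = R h^-1%g.
  rewrite -[LHS]mul1mx -R1 -(mulVg h) RM -mulmxA.
  by rewrite (mulmx1C (RU h)) mulmx1.
have G0 : 0 <= #|gT|%:R^-1 :> C by rewrite invr_ge0 ler0n.
(* In branch [g] the outcome standing for [x] is [lact g x], since the state tested there belongs to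
   [g * a] and [f (g * a)] is [lact g (f a)]. *)
pose M x := covariant_avg R (fun g => adjmx L *m E (lact g x) *m L).
pose S := covariant_avg R (fun g => adjmx L *m L).
have Mpsd x : psdmx (M x).
  by apply/psdmxZ/psdmx_sum => // g; do 2! apply: psdmx_conj.
have lact_inj g : injective (lact g).
  by move=> x y /(congr1 (lact g^-1%g)); rewrite -!lactM mulVg !lact1.
(* Each [g] permutes [X], so the effects [E (lact g x)] still sum to the identity. *)
have SE : S = \sum_x M x.
  rewrite /M -scaler_sumr exchange_big /=; congr (_ *: _).
  apply: eq_bigr => g _; rewrite -mulmx_suml -mulmx_sumr -mulmx_suml -mulmx_sumr.
  suff -> : \sum_x E (lact g x) = 1%:M by rewrite mulmx1.
  by rewrite -E1 [RHS](reindex_inj (@lact_inj g)).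
have Spsd : psdmx S by rewrite SE; apply: psdmx_sum.
(* Replacing [g] by [g * h^-1] turns the average on the right into the one on the left. *)
have RS h : R h *m S = S *m R h.
  rewrite /S /covariant_avg -scalemxAl -scalemxAr mulmx_sumr mulmx_suml.
  congr (_ *: _); rewrite [RHS](reindex_inj (mulIg h^-1%g)) /=.
  apply: eq_bigr => g _; rewrite RM adjmxM (adjR h^-1%g) invgK !mulmxA.
  by rewrite -[_ *m R h^-1%g *m _]mulmxA -RM mulVg R1 mulmx1.
(* [Q] is the square root of [S]; as [0^-1 = 0], [Qi] is its pseudo-inverse, and [K] is the
   projection onto the kernel of [S]. *)
pose Q := calcmx S sqrtC; pose Qi := calcmx S (fun x => (sqrtC x)^-1).
pose K := calcmx S (fun x => (x == 0)%:R).
have sqrtC_conj (x : C) : 0 <= x -> (sqrtC x)^* = sqrtC x.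
  by move=> x0; rewrite geC0_conj ?sqrtC_ge0.
have adjQ : adjmx Q = Q by rewrite calcmx_adj; apply: eq_calcmx.
have adjQi : adjmx Qi = Qi.
  by rewrite calcmx_adj; apply: eq_calcmx => // x x0; rewrite geC0_conj ?invr_ge0 ?sqrtC_ge0.
have QQ : Q *m Q = S.
  rewrite calcmxM -[RHS](calcmx_id Spsd); apply: eq_calcmx => // x _.
  by rewrite -expr2 sqrtCK.
have QiQ : Qi *m Q = 1%:M - K.
  rewrite calcmxM -(calcmx1 S) -calcmxB; apply: eq_calcmx => // x _.
  have [->|x0] := eqVneq x 0; first by rewrite sqrtC0 mulr0 subrr.
  by rewrite mulVf ?sqrtC_eq0 // subr0.
have QiSQi : Qi *m S *m Qi = 1%:M - K.
  rewrite -QQ mulmxA QiQ /K /Qi -(calcmx1 S) -calcmxB -mulmxA !calcmxM.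
  apply: eq_calcmx => // x _; have [->|x0] := eqVneq x 0.
    by rewrite subrr mul0r.
  by rewrite subr0 mul1r mulfV ?sqrtC_eq0.
have QK : Q *m K = 0.
  have -> : 0 = calcmx S (fun=> 0).
    by rewrite -(subrr (calcmx S (fun=> 0))) -calcmxB; apply: eq_calcmx => // x _; rewrite subrr.
  rewrite calcmxM; apply: eq_calcmx => // x _.
  by have [->|] := eqVneq x 0; rewrite ?sqrtC0 ?mul0r ?mulr0.
have avg_qform M' u : qform (covariant_avg R M') u
    = #|gT|%:R^-1 * \sum_g qform (M' g) (R g *m u).
  rewrite qformZ qform_sum; congr (_ * _); apply: eq_bigr => g _.
  by rewrite qform_conj.
have S_qform u : qform S u = #|gT|%:R^-1 * \sum_g qform 1%:M (L *m R g *m u).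
  rewrite avg_qform; congr (_ * _); apply: eq_bigr => g _.
  by rewrite -mulmxA -[in RHS]qform_conj mulmx1.
have G_unit : #|gT|%:R != 0 :> C by rewrite pnatr_eq0 -lt0n; apply/card_gt0P; exists 1%g.
(* [S] averages the Gram matrices of the [L *m R g], so they all vanish on its
   kernel. *)
have LRK g (u : 'cV_n) : L *m R g *m (K *m u) = 0.
  have /eqP := S_qform (K *m u); rewrite {1}/qform -mulmxA -QQ -mulmxA.
  rewrite [Q *m (K *m u)]mulmxA QK mul0mx !mulmx0 mxE eq_sym mulf_eq0 invr_eq0.
  rewrite (negPf G_unit) /= => /eqP/psumr_eq0P sum0.
  by apply/qform1_eq0/sum0 => // h _; apply: qform1_ge0.
(* The compressed effects sum only to [1%:M - K], so [K] is added to one outcome; [f 1%g] is a point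
   of [X] at hand. Since [Q *m K = 0], no probability changes. *)
exists (Q *m v), (fun x => Qi *m M x *m Qi + (x == f 1%g)%:R *: K); split.
- apply/unit_vectorE; rewrite -qform_conj mulmx1 adjQ QQ S_qform.
  rewrite (eq_bigr (fun=> 1)) => [|g _]; last exact/unit_vectorE.
  by rewrite sumr_const mulVf.
- split=> [x|].
    apply: psdmxD; first by rewrite -{1}adjQi; apply: psdmx_conj.
    by apply: psdmxZ; rewrite ?ler0n //; apply: calcmx_psd => // y _; rewrite ler0n.
  rewrite big_split /= -mulmx_suml -mulmx_sumr -SE QiSQi -scaler_suml.
  rewrite (bigD1 (f 1%g)) //= eqxx big1 ?addr0 ?scale1r ?subrK // => x.
  by move=> /negPf ->.
(* The new success probability at each single [a] already equals the old average: the sum over [g]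
   is reindexed by [g * a]. *)
rewrite /avg_success (eq_bigr (fun=> avg_success f E (fun a => L *m R a *m v))).
  by rewrite sumr_const -[RHS](mulKf G_unit) mulr_natl.
move=> a _; rewrite mulmxA (calcmx_comm Spsd _ (RS a)) -/Q -[Q *m R a *m v]mulmxA qformD qformZ.
rewrite [qform K _]/qform adjmxM adjQ -[_ *m Q *m K]mulmxA QK mulmx0 mul0mx mxE.
rewrite mulr0 addr0 -{1}adjQi qform_conj [Qi *m _]mulmxA QiQ avg_qform.
congr (_ * _); rewrite [RHS](reindex_inj (mulIg a)) /=; apply: eq_bigr => g _.
rewrite -fM qform_conj; congr (qform _ _).
by rewrite mulmxBl mul1mx mulmxA mulmxBr LRK subr0 RM !mulmxA.
Qed.

End HermitianMatrices.

(** * Kronecker products and tensor powers *)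

Section Kronecker.
Variable C : numClosedFieldType.

Lemma mxvec_indexK m n (i : 'I_m) (j : 'I_n) : tidx (mxvec_index i j) = (i, j).
Proof. by rewrite /tidx /mxvec_index cast_ordK enum_rankK. Qed.

Lemma tidxK m n (k : 'I_(m * n)) : mxvec_index (tidx k).1 (tidx k).2 = k.
Proof. by case/mxvec_indexP: k => i j; rewrite mxvec_indexK. Qed.

Lemma mxvec_index_eq m n (i i' : 'I_m) (j j' : 'I_n) :
  (mxvec_index i j == mxvec_index i' j') = (i == i') && (j == j').
Proof.
apply/eqP/andP=> [/(congr1 (@tidx m n))|[/eqP-> /eqP->] //].
by rewrite !mxvec_indexK => -[-> ->].
Qed.

Lemma big_mxvec_index (V : nmodType) m n (F : 'I_(m * n) -> V) :
  \sum_k F k = \sum_i \sum_j F (mxvec_index i j).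
Proof. by rewrite pair_big /= (reindex _ (curry_mxvec_bij m n)); apply: eq_bigr => -[]. Qed.

Lemma kronE m1 n1 m2 n2 (A : 'M[C]_(m1, n1)) (B : 'M_(m2, n2)) i j k l :
  kron A B (mxvec_index i k) (mxvec_index j l) = A i j * B k l.
Proof. by rewrite mxE !mxvec_indexK. Qed.

Lemma kronM m1 n1 p1 m2 n2 p2 (A : 'M[C]_(m1, n1)) (A' : 'M_(n1, p1))
    (B : 'M_(m2, n2)) (B' : 'M_(n2, p2)) :
  kron A B *m kron A' B' = kron (A *m A') (B *m B').
Proof.
apply/matrixP=> i j; case/mxvec_indexP: i => i k; case/mxvec_indexP: j => j l.
rewrite kronE !mxE big_mxvec_index big_distrlr /=.
by apply: eq_bigr => a _; apply: eq_bigr => b _; rewrite !kronE mulrACA.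
Qed.

Lemma adjmx_kron m1 n1 m2 n2 (A : 'M[C]_(m1, n1)) (B : 'M_(m2, n2)) :
  adjmx (kron A B) = kron (adjmx A) (adjmx B).
Proof. by apply/matrixP=> i j; rewrite !mxE rmorphM. Qed.

Lemma kron1 m n : kron (1%:M : 'M[C]_m) (1%:M : 'M_n) = 1%:M.
Proof.
apply/matrixP=> i j; case/mxvec_indexP: i => i k; case/mxvec_indexP: j => j l.
by rewrite kronE !mxE mxvec_index_eq -natrM mulnb.
Qed.

Lemma tpow1 d t : tpow (1%:M : 'M[C]_d) t = 1%:M.
Proof. by elim: t => //= t ->; rewrite kron1. Qed.

Lemma tpowM d (A B : 'M[C]_d) t : tpow (A *m B) t = tpow A t *m tpow B t.
Proof. by elim: t => /= [|t ->]; rewrite ?mulmx1 ?kronM. Qed.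

Lemma adjmx_tpow d (A : 'M[C]_d) t : adjmx (tpow A t) = tpow (adjmx A) t.
Proof. by elim: t => /= [|t IH]; rewrite ?adjmx1 // adjmx_kron IH. Qed.

Lemma unitary_rep_tpow (gT : finGroupType) d (pi : gT -> 'M[C]_d) t N :
  unitary_rep pi ->
  unitary_rep (fun g => kron (tpow (pi g) t) (1%:M : 'M_N)).
Proof.
move=> [pi1 [piM piU]]; split; first by rewrite pi1 tpow1 kron1.
split=> [g h|g]; first by rewrite piM tpowM kronM mulmx1.
by rewrite /Defs.unitarymx adjmx_kron kronM adjmx1 mulmx1 adjmx_tpow -tpowM piU tpow1 kron1.
Qed.

(** An empty sum of squares is not 1. This supplies the condition [0 < N] for both constructed
    algorithms. *)
Lemma unit_vector_dim n (v : 'cV[C]_n) : unit_vector v -> (0 < n)%N.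
Proof.
case: n v => // v /unit_vectorE; rewrite qform1E big_ord0 => /eqP.
by rewrite eq_sym oner_eq0.
Qed.

Lemma unit_vectorM n (U : 'M[C]_n) v :
  Defs.unitarymx U -> unit_vector v -> unit_vector (U *m v).
Proof.
by rewrite /unit_vector => UU v1; rewrite adjmxM mulmxA -[_ *m U]mulmxA UU mulmx1.
Qed.

Lemma unit_vector_adaptive d N (A : 'M[C]_d) (Us : seq 'M[C]_(d * N)) psi :
    Defs.unitarymx A -> (forall U, U \in Us -> Defs.unitarymx U) ->
  unit_vector psi -> unit_vector (adaptive_state A Us psi).
Proof.
move=> AU; rewrite /adaptive_state; elim: Us psi => //= U Us IH psi UU psi1.
apply: IH => [V VUs|]; first by apply: UU; rewrite inE VUs orbT.
apply: unit_vectorM; first by apply: UU; rewrite inE eqxx.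
apply: unit_vectorM => //.
by rewrite /Defs.unitarymx adjmx_kron kronM AU adjmx1 mulmx1 kron1.
Qed.

(** * Homogeneous polynomials in matrix entries as linear forms in a tensor power *)

Definition tensor_form d t (F : 'M[C]_d -> C) :=
  exists B : 'M[C]_(tdim d t), forall A, F A = \sum_i \sum_j B i j * tpow A t i j.

Lemma tensor_form_sum d t (I : finType) (F : I -> 'M[C]_d -> C) :
  (forall i, tensor_form t (F i)) -> tensor_form t (fun A => \sum_i F i A).
Proof.
move=> /fin_all_exists[B FB]; exists (\sum_k B k) => A.
under [RHS]eq_bigr => i _ do
  under eq_bigr => j _ do rewrite summxE mulr_suml.
under [RHS]eq_bigr => i _ do rewrite exchange_big.
by rewrite exchange_big; apply: eq_bigr => k _; rewrite FB.
Qed.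

Lemma tensor_form_scale d t c (F : 'M[C]_d -> C) :
  tensor_form t F -> tensor_form t (fun A => c * F A).
Proof.
move=> [B FB]; exists (c *: B) => A; rewrite FB mulr_sumr; apply: eq_bigr => i _.
by rewrite mulr_sumr; apply: eq_bigr => j _; rewrite mxE mulrA.
Qed.

(** The new leading tensor factor carries the extra entry, selected by [delta_mx p q]. *)
Lemma tensor_form_entry d t p q (F : 'M[C]_d -> C) :
  tensor_form t F -> tensor_form t.+1 (fun A => A p q * F A).
Proof.
move=> [B FB]; exists (kron (delta_mx p q) B) => A /=.
rewrite FB big_mxvec_index (bigD1 p) //= [X in _ + X]big1 ?addr0 => [|p' p'p].
  rewrite mulr_sumr; apply: eq_bigr => i _.
  rewrite big_mxvec_index (bigD1 q) //= [X in _ + X]big1 ?addr0 => [|q' q'q].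
    rewrite mulr_sumr; apply: eq_bigr => j _.
    by rewrite !kronE mxE !eqxx mul1r mulrCA.
  by rewrite big1 // => j _; rewrite kronE mxE (negPf q'q) andbF !mul0r.
rewrite big1 // => i _; rewrite big_mxvec_index big1 // => q' _.
by rewrite big1 // => j _; rewrite kronE mxE (negPf p'p) !mul0r.
Qed.

(** By induction on the last round: a query followed by a unitary makes each entry a combination,
    with coefficients independent of [A], of an entry of [A] times an earlier entry, so the degree
    grows by one. *)
Lemma tensor_form_adaptive d N (Us : seq 'M[C]_(d * N)) psi k :
  tensor_form (size Us) (fun A => adaptive_state A Us psi k 0).
Proof.
rewrite /adaptive_state; elim/last_ind: Us k => [|Us U IH] k /=.
  exists (psi k 0)%:M => A.
  by rewrite /= !big_ord1 !mxE eqxx !mulr1n mulr1.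
rewrite size_rcons.
have [B FB] : tensor_form (size Us).+1 (fun A => \sum_a (U k a *
   \sum_b \sum_c (A (tidx a).1 b * ((1%:M : 'M_N) (tidx a).2 c *
      foldl (fun s U => U *m (kron A (1%:M : 'M_N) *m s)) psi Us (mxvec_index b c) 0)))).
  apply: tensor_form_sum => a; apply: tensor_form_scale.
  apply: tensor_form_sum => b; apply: tensor_form_sum => c.
  by apply/tensor_form_entry/tensor_form_scale/IH.
exists B => A; rewrite -FB foldl_rcons mxE; apply: eq_bigr => a _; congr (_ * _).
rewrite mxE big_mxvec_index; apply: eq_bigr => b _; apply: eq_bigr => c _.
by rewrite mxE mxvec_indexK mulrA.
Qed.

(* [v] is the unnormalised maximally entangled vector: applying [tpow A t (x) 1] to
   it lists the entries of [tpow A t]. *)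
Lemma tensor_form_factor d t p (F : 'I_p -> 'M[C]_d -> C) :
    (forall k, tensor_form t (F k)) ->
  exists (L : 'M[C]_(p, tdim d t * tdim d t)) (v : 'cV_(tdim d t * tdim d t)),
    forall A, L *m kron (tpow A t) 1%:M *m v = \col_k F k A.
Proof.
move=> /fin_all_exists[B FB].
exists (\matrix_(k, a) B k (tidx a).1 (tidx a).2).
exists (\col_a ((tidx a).1 == (tidx a).2)%:R) => A.
apply/colP=> k; rewrite -mulmxA !mxE FB big_mxvec_index; apply: eq_bigr => i _.
apply: eq_bigr => j _; rewrite mxE mxvec_indexK; congr (_ * _).
rewrite mxE big_mxvec_index (bigD1 j) //= [X in _ + X]big1 ?addr0 => [|a aj].
  rewrite (bigD1 j) //= [X in _ + X]big1 ?addr0 => [|b bj].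
    by rewrite kronE !mxE mxvec_indexK !eqxx !mulr1.
  by rewrite !mxE !mxvec_indexK /= eq_sym (negPf bj) !(mulr0, mul0r).
rewrite big1 // => b _; rewrite !mxE !mxvec_indexK /=.
have [<-|] := eqVneq j b; last by rewrite !(mulr0, mul0r).
by rewrite (negPf aj) mulr0.
Qed.

(** * Permutations of tensor factors and the splitting of parallel queries *)

Definition isounitary m n (S : 'M[C]_(m, n)) :=
  S *m adjmx S = 1%:M /\ adjmx S *m S = 1%:M.

Lemma isounitaryM m n p (S : 'M[C]_(m, n)) (T : 'M_(n, p)) :
  isounitary S -> isounitary T -> isounitary (S *m T).
Proof.
move=> [S1 S2] [T1 T2]; split; rewrite adjmxM mulmxA.
  by rewrite -[_ *m T *m _]mulmxA T1 mulmx1.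
by rewrite -[_ *m adjmx S *m S]mulmxA S2 mulmx1.
Qed.

Lemma isounitary_kron1 d m n (S : 'M[C]_(m, n)) :
  isounitary S -> isounitary (kron (1%:M : 'M_d) S).
Proof. by move=> [S1 S2]; split; rewrite adjmx_kron kronM adjmx1 mulmx1 ?S1 ?S2 kron1. Qed.

(** Reindexing is conjugation by the permutation matrix [rowsub h 1%:M]. It is typed as rectangular
    because regrouped dimensions such as [(a * b) * c] and [a * (b * c)] are not convertible. *)
Lemma isounitary_reindex m n (h : 'I_m -> 'I_n) : bijective h ->
  exists S : 'M[C]_(m, n), isounitary S /\
    forall B, mxsub h h B = S *m B *m adjmx S.
Proof.
move=> h_bij; exists (rowsub h 1%:M).
have sub B : mxsub h h B = rowsub h 1%:M *m B *m adjmx (rowsub h (1%:M : 'M[C]_n)).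
  apply/matrixP=> i j; rewrite -rowsubE !mxE (bigD1 (h j)) //= big1 ?addr0.
    by rewrite !mxE eqxx conjC1 mulr1.
  by move=> k kj; rewrite !mxE eq_sym (negPf kj) conjC0 mulr0.
split=> //; split.
  rewrite -[X in X *m _]mulmx1 -sub; apply/matrixP=> i j.
  by rewrite !mxE (inj_eq (bij_inj h_bij)).
apply/matrixP=> i j; rewrite mxE.
transitivity (\sum_k ((k == i)%:R^* * (k == j)%:R : C)).
  rewrite [RHS](reindex h) /=; last exact: onW_bij.
  by apply: eq_bigr => k _; rewrite !mxE.
rewrite (bigD1 i) //= big1 ?addr0 ?eqxx ?conjC1 ?mul1r ?mxE // => k ki.
by rewrite (negPf ki) conjC0 mul0r.
Qed.

Lemma kron_assoc a b c : exists T : 'M[C]_((a * b) * c, a * (b * c)),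
  isounitary T /\ forall A B D, kron (kron A B) D = T *m kron A (kron B D) *m adjmx T.
Proof.
pose h (k : 'I_((a * b) * c)) : 'I_(a * (b * c)) :=
  mxvec_index (tidx (tidx k).1).1 (mxvec_index (tidx (tidx k).1).2 (tidx k).2).
pose h' (k : 'I_(a * (b * c))) : 'I_((a * b) * c) :=
  mxvec_index (mxvec_index (tidx k).1 (tidx (tidx k).2).1) (tidx (tidx k).2).2.
have [|T [TU TE]] := @isounitary_reindex _ _ h.
  by exists h' => k; rewrite /h /h' !mxvec_indexK /= !tidxK.
exists T; split=> // A B D; rewrite -TE; apply/matrixP=> i j.
by rewrite !mxE !mxvec_indexK /= mulrA.
Qed.

(** Exchanging the first two factors brings the one on which [A] acts to the front. *)
Lemma kron_swap a b c : exists T : 'M[C]_(a * (b * c), b * (a * c)),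
  isounitary T /\ forall A, kron 1%:M (kron A 1%:M) = T *m kron A 1%:M *m adjmx T.
Proof.
pose h a b (k : 'I_(a * (b * c))) : 'I_(b * (a * c)) :=
  mxvec_index (tidx (tidx k).2).1 (mxvec_index (tidx k).1 (tidx (tidx k).2).2).
have [|T [TU TE]] := @isounitary_reindex _ _ (h a b).
  by exists (h b a) => k; rewrite /h !mxvec_indexK /= !tidxK.
exists T; split=> // A; rewrite -TE -kron1; apply/matrixP=> i j.
by rewrite !mxE !mxvec_indexK /= mulrCA.
Qed.

(* The head of [Ss] gives the rightmost factor, i.e. the one applied first. *)
Fixpoint conjprod m n (K : 'M[C]_n) (Ss : seq 'M[C]_(m, n)) : 'M[C]_m :=
  if Ss is T :: Ss' then conjprod K Ss' *m (T *m K *m adjmx T) else 1%:M.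

(** [A] on the first factor times the remaining power on the others: the induction hypothesis splits
    the latter. [N'] is a variable with an equation so that the dimension can be reassociated inside
    types. *)
Lemma tpow_conjprod d t N N' : N' = (tdim d t * N)%N ->
  exists Ss : seq 'M[C]_(tdim d t.+1 * N, d * N'),
    [/\ size Ss = t.+1, forall S, S \in Ss -> isounitary S &
        forall A, kron (tpow A t.+1) 1%:M = conjprod (kron A 1%:M) Ss].
Proof.
elim: t N' => [|t IH] N' N'E.
  rewrite {N'}N'E; have [T [TU TE]] := kron_assoc d 1 N.
  exists [:: T]; split=> // [S|A /=]; first by rewrite inE => /eqP ->.
  by rewrite mul1mx TE kron1.
have [Ss [szS SU SE]] := IH _ erefl.
have [T [TU TE]] := kron_assoc d (tdim d t.+1) N.
have [Q [QU QE]] := kron_swap d d (tdim d t * N).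
(* [T0] is [T] with its column dimension expressed through [N'], so that it fits in one list with
   the other factors after [N'] is reassociated. *)
have [T0 [T0U T0E]] : exists T0 : 'M[C]_(tdim d t.+2 * N, d * N'), isounitary T0 /\
    forall A, kron (kron A 1%:M) 1%:M = T0 *m kron A 1%:M *m adjmx T0.
  by rewrite N'E; exists T; split=> // A; rewrite TE kron1.
have N'E' : N' = (d * (tdim d t * N))%N by rewrite N'E mulnA.
move: T0 T0U T0E; rewrite {N' N'E}N'E' => T0 T0U T0E.
(* [T0] handles the first factor. Each old [V] acts behind an idle first factor, and [Q] swaps its
   query to the front. *)
exists (T0 :: [seq T *m (kron 1%:M V *m Q) | V <- Ss]); split.
- by rewrite /= size_map szS.
- move=> S; rewrite inE => /orP[/eqP -> //|/mapP[S' /SU S'U ->]].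
  by apply: isounitaryM => //; apply: isounitaryM => //; apply: isounitary_kron1.
move=> A /=; rewrite -T0E.
suff -> : conjprod (kron A 1%:M) [seq T *m (kron 1%:M V *m Q) | V <- Ss]
    = T *m kron 1%:M (conjprod (kron A 1%:M) Ss) *m adjmx T.
  by rewrite -SE -TE !kronM !mulmx1 mul1mx.
have [TT1 TT2] := TU; elim: Ss {szS SU SE} => [|S Ss IHS] /=.
  by rewrite kron1 mulmx1 TT1.
rewrite IHS !adjmxM !mulmxA; set M := conjprod _ _.
have -> : kron 1%:M (M *m S *m kron A 1%:M *m adjmx S) = kron (1%:M : 'M_d) M *m
    kron 1%:M S *m kron 1%:M (kron A 1%:M) *m adjmx (kron 1%:M S).
  by rewrite adjmx_kron adjmx1 !kronM !mulmx1.
rewrite QE -!mulmxA; congr (_ *m (_ *m _)).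
by rewrite [adjmx T *m (T *m _)]mulmxA TT2 mul1mx.
Qed.

(** Adjacent factors meet in [adjmx S' *m S], the unitary between two queries. The first adjoint
    prepares the initial vector, the last matrix becomes [T], and the last unitary is the
    identity. *)
Lemma conjprod_adaptive d m N (S : 'M[C]_(m, d * N)) Ss :
    (forall S', S' \in S :: Ss -> isounitary S') ->
  exists (Us : seq 'M[C]_(d * N)) (T : 'M_(m, d * N)),
    [/\ size Us = (size Ss).+1, forall U, U \in Us -> Defs.unitarymx U,
        isounitary T &
        forall A v, conjprod (kron A 1%:M) (S :: Ss) *m v
                    = T *m adaptive_state A Us (adjmx S *m v)].
Proof.
elim: Ss S => [|S' Ss IH] S SU.
  exists [:: 1%:M], S; split=> //; last by move=> A v; rewrite /= !mul1mx !mulmxA.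
    by move=> U; rewrite inE => /eqP ->; rewrite /Defs.unitarymx adjmx1 mulmx1.
  by apply: SU; rewrite inE eqxx.
have [|Us [T [szU UU TU TE]]] := IH S'.
  by move=> S0 S0in; apply: SU; rewrite inE S0in orbT.
have [_ S1] : isounitary S by apply: SU; rewrite inE eqxx.
have [S'1 _] : isounitary S' by apply: SU; rewrite !inE eqxx orbT.
exists (adjmx S' *m S :: Us), T; split=> //; first by rewrite /= szU.
  move=> U; rewrite inE => /orP[/eqP ->|]; last exact: UU.
  by rewrite /Defs.unitarymx adjmxM adjmxK mulmxA -[_ *m S' *m _]mulmxA S'1 mulmx1 S1.
move=> A v; have := TE A (S *m kron A 1%:M *m adjmx S *m v).
by rewrite /= !mulmxA.
Qed.

End Kronecker.

(** * Equivalence of adaptive and nonadaptive success probabilities *)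

Theorem theorem1 (C : numClosedFieldType) (gT : finGroupType) (X : finType)
  (d : nat) (pi : gT -> 'M[C]_d) (lact : gT -> X -> X) (f : gT -> X)
  (t : nat) (P : C) :
  unitary_rep pi -> coset_identification lact f ->
  (1 <= t)%N -> 0 <= P <= 1 ->
  adaptive_algorithm_exists pi f t P <-> nonadaptive_algorithm_exists pi f t P.
Proof.
move=> pi_rep f_coset t_gt0 _; split.
  case=> N [psi [Us [E [_ psi1 szU UU [E_POVM <-]]]]].
  have [L [v LE]] := tensor_form_factor (tensor_form_adaptive Us psi).
  have state_eq a : L *m kron (tpow (pi a) (size Us)) 1%:M *m v
      = adaptive_state (pi a) Us psi.
    by rewrite LE; apply/colP=> k; rewrite mxE.
  have [|phi [E' [phi1 E'_POVM success_eq]]] := nonadaptive_transfer (L := L) (v := v)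
    (unitary_rep_tpow (size Us) (tdim d (size Us)) pi_rep) f_coset _ E_POVM.
    move=> a; rewrite state_eq.
    by apply: unit_vector_adaptive => //; case: pi_rep => _ [].
  rewrite -szU.
  (* The ancilla is a second copy of the tensor power, as required by the maximally entangled vector
     [v]. *)
  exists (tdim d (size Us)), phi, E'; split=> //.
    by have := unit_vector_dim phi1; rewrite muln_gt0 => /andP[].
  rewrite [LHS]success_eq; congr (_ * _); apply: eq_bigr => a _.
  by rewrite state_eq.
case: t t_gt0 => // t _ [N [psi [E [_ psi1 [Epsd E1] <-]]]].
have [[|S Ss] [szS SU SE]] // := @tpow_conjprod C d t N _ erefl.
have [Us [T [szU UU [T1 T2] TE]]] := conjprod_adaptive SU.
have [SS1 _] : isounitary S by apply: SU; rewrite inE eqxx.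
have phi1 : unit_vector (adjmx S *m psi).
  by rewrite /unit_vector adjmxM adjmxK mulmxA -[_ *m S *m _]mulmxA SS1 mulmx1.
(* There are now [t.+1] queries: the ancilla holds the [t] factors other than the queried one
   together with the old ancilla, and [T] is absorbed into the measurement. *)
exists (tdim d t * N)%N, (adjmx S *m psi), Us, (fun x => adjmx T *m E x *m T).
split=> //; first by have := unit_vector_dim phi1; rewrite muln_gt0 => /andP[].
  exact: etrans szU szS.
split; first split=> [x|]; first exact: psdmx_conj.
  by rewrite -mulmx_suml -mulmx_sumr E1 mulmx1.
congr (_ * _); apply: eq_bigr => a _.
by rewrite qform_conj -TE -SE.
Qed.
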